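(* Let $N\ge1$ and let $x_1,\dots,x_N$ be real. Let $d_k=d_k(x_1,\dots,x_N)$ be the coefficients in $$P(t)=t(1-t)\prod_{i=1}^N(1-x_it)=\sum_{k=0}^{N+2}d_kt^k .$$ Then $$d_k=(-1)^{k-1}\bigl[\sigma_{k-1}(x_1,\dots,x_N)+\sigma_{k-2}(x_1,\dots,x_N)\bigr],\qquad k=0,\dots,N+2 .$$
   Context: $\sigma_l(y_1,\dots,y_k)$ is the $l$-th elementary symmetric polynomial in $k$ variables, with $\sigma_0=1$ (also for $k=0$) and $\sigma_l=0$ if $l<0$ or $l>k$. *)

(* Defs.v *)
From mathcomp Require Import all_boot all_order all_algebra.
From mathcomp Require Import reals.
From mathcomp Require Import mpoly.

Set Implicit Arguments.
Unset Strict Implicit.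
Unset Printing Implicit Defensive.

Import GRing.Theory.
Local Open Scope ring_scope.

(* mesym already gives sigma_0 = 1 and sigma_l = 0 for l > n; the index is
   extended to int so that sigma_{k-1} and sigma_{k-2} make sense for k < 2. *)
Definition sigma (R : realType) (n : nat) (l : int) : {mpoly R[n]} :=
  match l with
  | Posz m => mesym n R m
  | Negz _ => 0
  end.

Definition P (R : realType) (N : nat) (x : 'I_N -> R) : {poly R} :=
  'X * (1 - 'X) * \prod_(i < N) (1 - x i *: 'X).

Definition d (R : realType) (N : nat) (x : 'I_N -> R) (k : nat) : R :=
  (P x)`_k.

Lemma P_expansion (R : realType) (N : nat) (x : 'I_N -> R) :
  P x = \sum_(k < N.+3) d x k *: 'X^k.
Proof.
have lin (a : R) : (size (1 - a *: 'X : {poly R})%R <= 2)%N.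
  rewrite (leq_trans (size_polyD _ _)) // size_polyN geq_max size_poly1 /=.
  by rewrite (leq_trans (size_scale_leq _ _)) // size_polyX.
have prodS : (size (\prod_(i < N) (1 - x i *: 'X : {poly R}))%R <= N.+1)%N.
  elim: N x => [|N IH] x; first by rewrite big_ord0 size_poly1.
  rewrite big_ord_recl (leq_trans (size_polyMleq _ _)) //.
  by rewrite -subn1 leq_subLR (leq_add (lin _) (IH _)).
have sP : (size (P x) <= N.+3)%N.
  rewrite /P -mulrA mulrC (leq_trans (size_polyMleq _ _)) //.
  rewrite size_polyX addn2 /= ltnS (leq_trans (size_polyMleq _ _)) //.
  have l1 := lin 1; rewrite scale1r in l1.
  by rewrite -subn1 leq_subLR (leq_add l1 prodS).
rewrite -poly_def; apply/polyP => k; rewrite coef_poly.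
by case: ltnP => // le_k; rewrite nth_default // (leq_trans sP).
Qed.

(* Main.v *)
Require Import Defs.
From mathcomp Require Import all_boot all_order all_algebra.
From mathcomp Require Import reals.
From mathcomp Require Import mpoly.

Import GRing.Theory.
Local Open Scope ring_scope.

(** This is Vieta's formula in reversed form. Choosing from each factor
[1 - x i *: 'X] either [1] or [- x i *: 'X], a set [h] of indices at which
the second term is chosen contributes to ['X^#|h|], so the coefficient of
['X^m] in the product is the elementary symmetric polynomial of degree [m] up
to the sign [(-1) ^+ m] ([coef_prod_1subZX]). Multiplying by ['X * (1 - 'X)]
shifts the coefficients by one place and subtracts from them their shift by
two places; the signs of two consecutive coefficients being opposite, this
difference becomes a sum of two consecutive elementary symmetric
polynomials. *)

(** Only the subsets of cardinal [m] contribute in degree [m], and these are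
exactly the subsets that index [mesym]. No bound on [m] is imposed: for
[n < m] there is no such subset, and both sides vanish. *)
Lemma coef_prod_1subZX (R : comNzRingType) (n m : nat) (x : 'I_n -> R) :
  (\prod_(i < n) (1 - x i *: 'X))`_m = (-1) ^+ m * (mesym n R m).@[x].
Proof.
have -> : \prod_(i < n) (1 - x i *: 'X)
    = \sum_(h : {set 'I_n}) ((-1) ^+ #|h| * \prod_(i in h) x i) *: 'X^#|h|.
  under eq_bigr do rewrite addrC -scaleNr.
  rewrite bigA_distr; apply: eq_bigr => h _.
  by rewrite -big_mkcond /= scaler_prodr prodrN.
rewrite coef_sum /mesym raddf_sum /= mulr_sumr [RHS]big_mkcond /=.
apply: eq_bigr => h _; rewrite coefZ coefXn eq_sym.
case: eqP => [<-|_]; last by rewrite mulr0.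
by rewrite mulr1 rmorph_prod; under [in RHS]eq_bigr do rewrite /= mevalXU.
Qed.

Theorem lemma4p2 (R : realType) (N : nat) (hN : (1 <= N)%N) (x : 'I_N -> R)
    (k : nat) (hk : (k <= N + 2)%N) :
  d x k = (-1) ^ (k%:Z - 1)
          * ((sigma R N (k%:Z - 1)).@[x] + (sigma R N (k%:Z - 2)).@[x]).
Proof.
rewrite /d /P -mulrA coefXM mulrBl mul1r coefB coefXM.
case: k hk => [|[|m]] _.
- by rewrite /= meval0 addr0 mulr0.
- by rewrite /= meval0 addr0 subr0 coef_prod_1subZX.
have -> : m.+2%:Z - 1 = m.+1%:Z by rewrite -[m.+2]addn1 PoszD addrK.
have -> : m.+2%:Z - 2 = m%:Z by rewrite -[m.+2]addn2 PoszD addrK.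
rewrite /= !coef_prod_1subZX -exprnP mulrDr.
by rewrite [in X in _ = _ + X]exprS !mulN1r mulNr.
Qed.
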